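(* Let $\varkappa:\mathbb{R}_+\to\mathbb{R}$ be bounded and measurable with $m_2(\varkappa)<\infty$ and $\inf_{x\in[1,e]}\varkappa(x)>0$. Let $h:\mathbb{R}_+\to\mathbb{R}_+$ be a bounded, locally integrable function. Then $$\lim_{m\to\infty}\mathscr{M}^{\varkappa}_m(h,z)=h(z)$$ at each log-continuity point $z\in\mathbb{R}_+$ of $h$. Moreover, if $h\in\mathscr{V}^{\mathrm{w}}_+(\mathbb{R}_+)$, then $$\lim_{m\to\infty}\|\mathscr{M}^{\varkappa}_m(h,\cdot)-h\|_{\mathrm{w}}=0.$$
   Context: $\mathbb{R}_+$ is the set of positive reals; $\bigvee_{j\in\Lambda}T_j:=\sup\{T_j: j\in\Lambda\}$; the parameter $m>0$ is real. The weight is $\mathrm{w}(z)=\frac{1}{1+\log^2 z}$ and $\|h\|_{\mathrm{w}}=\sup_{z>0}\mathrm{w}(z)|h(z)|$. A function $f:\mathbb{R}_+\to\mathbb{R}$ is log-continuous at $z$ if for every $\epsilon>0$ there is $\rho>0$ with $|f(u)-f(z)|<\epsilon$ whenever $|\log u-\log z|\le\rho$; it is log-uniformly continuous if for every $\epsilon>0$ there is $\rho>0$ such that $|f(z_1)-f(z_2)|<\epsilon$ whenever $|\log z_1-\log z_2|\le\rho$, $z_1,z_2>0$. $\mathscr{V}(\mathbb{R}_+)$ is the space of bounded log-uniformly continuous functions on $\mathbb{R}_+$; $\mathscr{V}^{\mathrm{w}}(\mathbb{R}_+)=\{h:\mathbb{R}_+\to\mathbb{R}:\ \mathrm{w}h\in\mathscr{V}(\mathbb{R}_+)\}$,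 and $\mathscr{V}^{\mathrm{w}}_+(\mathbb{R}_+)$ is the subclass of its nonnegative functions. The discrete absolute moment of order $2$ is $m_2(\varkappa)=\sup_{s>0}\bigvee_{j\in\mathbb{Z}}|\varkappa(e^{-j}s)|\,|j-\log s|^{2}$. For locally integrable $h:\mathbb{R}_+\to\mathbb{R}$, $m>0$ and $z>0$, $$\mathscr{M}^{\varkappa}_m(h,z)=\frac{\bigvee_{j\in\mathbb{Z}}\varkappa(e^{-j}z^m)\,m\int_{j/m}^{(j+1)/m}h(e^v)\,dv}{\bigvee_{j\in\mathbb{Z}}\varkappa(e^{-j}z^m)}.$$ *)

(* Defs.v *)
From HB Require Import structures.
From mathcomp Require Import all_boot all_order all_algebra.
From mathcomp Require Import all_classical all_reals all_analysis.

Set Implicit Arguments.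
Unset Strict Implicit.
Unset Printing Implicit Defensive.

Import Order.TTheory GRing.Theory Num.Theory.
Import numFieldNormedType.Exports.

Local Open Scope classical_set_scope.
Local Open Scope ring_scope.
Local Open Scope ereal_scope.

(* Functions on the positive reals are represented by total functions R -> R
   of which only the values on ]0, +oo[ matter.  Suprema are taken in \bar R,
   so that an unbounded family has supremum +oo and not a default value. *)

(* [R] with the Lebesgue (completed) sigma-algebra; [measurableType] on [R]
   itself is the Borel one. *)
Definition lebesgueType (R : realType) : measurableType _ :=
  caratheodory_type (wlength (@idfun R))^*%mu.

Definition lebesgue_measurable_fun (R : realType) (D : set R) (f : R -> R) :
  Prop := measurable_fun (D : set (lebesgueType R)) (f : lebesgueType R -> R).

(* Same as the library's [locally_integrable], with Lebesgue instead of Borel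
   measurability. *)
Definition lebesgue_locally_integrable (R : realType) (D : set R) (f : R -> R) :
  Prop :=
  [/\ lebesgue_measurable_fun D f, open D &
    forall K, K `<=` D -> compact K ->
      \int[@completed_lebesgue_measure R]_(x in K) `|f x|%:E < +oo].

Definition log_continuous_at (R : realType) (f : R -> R) (z : R) : Prop :=
  (forall eps, 0 < eps -> exists2 rho, 0 < rho &
    forall u, 0 < u -> `|ln u - ln z| <= rho -> `|f u - f z| < eps)%R.

Definition log_uniformly_continuous (R : realType) (f : R -> R) : Prop :=
  (forall eps, 0 < eps -> exists2 rho, 0 < rho &
    forall z1 z2, 0 < z1 -> 0 < z2 ->
      `|ln z1 - ln z2| <= rho -> `|f z1 - f z2| < eps)%R.

Definition V_space (R : realType) : set (R -> R) :=
  [set f | [bounded f z | z in `]0%R, +oo[] /\ log_uniformly_continuous f].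

Definition weight (R : realType) (z : R) : R := ((1 + ln z ^+ 2)^-1)%R.

Definition weighted_V_space (R : realType) : set (R -> R) :=
  [set h | V_space (fun z => weight z * h z)%R].

Definition weighted_V_space_nneg (R : realType) : set (R -> R) :=
  [set h | weighted_V_space h /\ forall z, (0 < z)%R -> (0 <= h z)%R].

Definition weighted_norm (R : realType) (f : R -> \bar R) : \bar R :=
  ereal_sup [set (weight z)%:E * `|f z| | z in `]0%R, +oo[].

Definition discrete_moment2 (R : realType) (kappa : R -> R) : \bar R :=
  ereal_sup [set ereal_sup
    [set (`|kappa (expR (- j%:~R) * s)| * `|j%:~R - ln s| ^+ 2)%:E
      | j in [set: int]] | s in `]0%R, +oo[].

Definition max_kantorovich (R : realType) (kappa h : R -> R) (m z : R) :
  \bar R :=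
  ereal_sup [set (kappa (expR (- j%:~R) * z `^ m))%:E *
      (m%:E * \int[@completed_lebesgue_measure R]_(v in
         `[(j%:~R / m)%R, ((j%:~R + 1) / m)%R]) (h (expR v))%:E)
    | j in [set: int]]
  / ereal_sup [set (kappa (expR (- j%:~R) * z `^ m))%:E | j in [set: int]].

(* Main.v *)
(* Fix [z] and a weight [w > 0], and suppose that
   [w * |h (e^v) - h z| <= eps + C (v - log z)^2] for all [v].  Then the [j]-th
   mean in the numerator differs from [h z] by at most
   [(eps + 2 C ((j - m log z)^2 + 1) / m^2) / w].  Multiplying by
   [|kappa (e^-j z^m)|], the moment condition absorbs [(j - m log z)^2], so every
   term of the numerator is [O(eps) + O(1 / m^2)] away from [h z] times its
   weight.  The same then holds for the suprema, and the denominator is at least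
   [inf_[1,e] kappa] because some [e^-j z^m] lies in [[1, e]].  The quadratic
   hypothesis holds with [w = 1] when [h] is bounded and log-continuous at [z],
   and with [w = weight z] and [C] independent of [z] when [weight * h] is bounded
   and log-uniformly continuous. *)

Require Import Defs.
From HB Require Import structures.
From mathcomp Require Import all_boot all_order all_algebra.
From mathcomp Require Import all_classical all_reals all_analysis.
From mathcomp Require Import ring lra.

Set Implicit Arguments.
Unset Strict Implicit.
Unset Printing Implicit Defensive.

Import Order.TTheory GRing.Theory Num.Theory.
Import numFieldNormedType.Exports.

Local Open Scope classical_set_scope.
Local Open Scope ring_scope.
Local Open Scope ereal_scope.

(** * Averages over compact intervals *)

(* [h \o expR] need not be Borel; the integral of a nonnegative function is a
   supremum over simple functions below it, hence monotone in any case. *)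
Lemma ge0_le_integral_nomeas d (T : measurableType d) (R : realType)
    (mu : {measure set T -> \bar R}) (D : set T) (f g : T -> \bar R) :
  (forall x, D x -> 0 <= f x) -> (forall x, D x -> f x <= g x) ->
  \int[mu]_(x in D) f x <= \int[mu]_(x in D) g x.
Proof.
move=> f0 fg; have g0 x : D x -> 0 <= g x.
  by move=> Dx; exact: le_trans (f0 _ Dx) (fg _ Dx).
rewrite !ge0_integralE//; apply: ereal_sup_le => _ [s sf <-]; exists s => // x.
exact/(le_trans (sf x))/lee_restrict.
Qed.

Lemma completed_lebesgue_measure_itvcc (R : realType) (a b : R) : (a <= b)%R ->
  measurable (`[a, b] : set (lebesgueType R)) /\
  @completed_lebesgue_measure R `[a, b] = (b - a)%:E.
Proof.
move=> ab; split.
  apply: sub_caratheodory.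
  have : measurable (`[a, b] : set (measurableTypeR R)).
    exact: measurable_itv.
  by [].
(* Both sides are values of one outer measure, hence convertible; only the sigma-algebras differ. *)
transitivity (@lebesgue_measure R `[a, b]); first by [].
rewrite lebesgue_measure_itv/= lte_fin; case: ltP => // ba.
by have -> : a = b by [apply/eqP; rewrite eq_le ab]; rewrite subrr.
Qed.

Lemma mean_itv_dist (R : realType) (f : R -> R) (a b m c d : R) :
  (a <= b -> m * (b - a) = 1 ->
  (forall v, a <= v <= b -> 0 <= f v) ->
  (forall v, a <= v <= b -> `|f v - c| <= d) ->
  exists2 r, (m%:E * \int[@completed_lebesgue_measure R]_(v in `[a, b])
    (f v)%:E)%E = r%:E & `|r - c| <= d)%R.
Proof.
move=> ab mab f0 fcd.
have [mI lI] := completed_lebesgue_measure_itvcc ab.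
have m0 : (0 <= m)%R.
  rewrite leNgt; apply/negP => m0.
  suff : (m * (b - a) <= 0)%R by rewrite mab ler10.
  by rewrite mulr_le0_ge0 ?subr_ge0// ltW.
set J := \int[_]_(_ in _) _.
have cstE (r : R) : \int[@completed_lebesgue_measure R]_(v in `[a, b]) r%:E =
    (r * (b - a))%:E.
  by rewrite integral_cst// EFinM; congr (_ * _).
(* [c - d] may be negative, but the comparison of integrals needs a nonnegative minorant; the cut at
   0 is dropped at the end. *)
have lbJ : (Num.max 0 (c - d) * (b - a))%:E <= J.
  rewrite -cstE; apply: ge0_le_integral_nomeas => v /=; rewrite in_itv/= => vI.
    by rewrite lee_fin le_max lexx.
  rewrite lee_fin ge_max f0//=; have := fcd _ vI; rewrite ler_norml.
  by case/andP; lra.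
have ubJ : J <= ((c + d) * (b - a))%:E.
  rewrite -cstE; apply: ge0_le_integral_nomeas => v /=; rewrite in_itv/= => vI.
    by rewrite lee_fin f0.
  by rewrite lee_fin; have := fcd _ vI; rewrite ler_norml => /andP[]; lra.
have Jfin : J \is a fin_num.
  by rewrite fin_real// (lt_le_trans (ltNyr _) lbJ) (le_lt_trans ubJ (ltry _)).
move: lbJ ubJ; rewrite -(fineK Jfin) !lee_fin.
move: (fine J) => {Jfin J}J lbJ ubJ.
exists (m * J)%R; first by rewrite EFinM.
have /(ler_wpM2l m0) := lbJ; rewrite mulrCA mab mulr1 ge_max => /andP[_ lb].
have /(ler_wpM2l m0) := ubJ; rewrite mulrCA mab mulr1 => ub.
by rewrite ler_norml; lra.
Qed.

(** * Quotients of suprema *)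

(* If [D] is the supremum of the weights, that of the products is within [d] of
   [c * D]; signed weights are harmless because [c] is nonnegative. *)
Lemma sup_quotient_dist (R : realType) (I : Type) (k r : I -> R)
    (B theta c d : R) (i0 : I) :
  (0 < theta -> 0 <= c -> theta <= k i0 ->
  (forall i, k i <= B) -> (forall i, `|k i| * `|r i - c| <= d) ->
  exists2 q, (ereal_sup [set (k i * r i)%:E | i in [set: I]] /
    ereal_sup [set (k i)%:E | i in [set: I]])%E = q%:E &
    `|q - c| <= d / theta)%R.
Proof.
move=> theta0 c0 ki0 kB krd.
set N := ereal_sup _; set D := ereal_sup _.
have {}krd i : (`|k i * r i - k i * c| <= d)%R by rewrite -mulrBr normrM.
have kD i : (k i)%:E <= D by apply: ereal_sup_ubound; exists i.
have krN i : (k i * r i)%:E <= N by apply: ereal_sup_ubound; exists i.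
have DB : D <= B%:E.
  by apply: ge_ereal_sup => _ [i _ <-]; rewrite lee_fin.
have Dfin : D \is a fin_num.
  by rewrite fin_real// (lt_le_trans (ltNyr _) (kD i0)) (le_lt_trans DB (ltry _)).
have DE := fineK Dfin; set D' := fine D in DE.
have thetaD : (theta <= D')%R.
  by rewrite -lee_fin DE (le_trans _ (kD i0))// lee_fin.
have {}kD i : (k i <= D')%R by rewrite -lee_fin DE.
have NB : N <= (c * D' + d)%:E.
  apply: ge_ereal_sup => _ [i _ <-]; rewrite lee_fin.
  have := krd i; rewrite ler_norml => /andP[_ +].
  by have := ler_wpM2l c0 (kD i); lra.
have Nfin : N \is a fin_num.
  by rewrite fin_real// (lt_le_trans (ltNyr _) (krN i0)) (le_lt_trans NB (ltry _)).
have NE := fineK Nfin; set N' := fine N in NE.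
have {}krN i : (k i * r i <= N')%R by rewrite -lee_fin NE.
have {}NB : (N' <= c * D' + d)%R by rewrite -lee_fin NE.
have NB' : (c * D' - d <= N')%R.
  have kN i : (c * k i <= N' + d)%R.
    by have := krd i; rewrite ler_norml => /andP[+ _]; have := krN i; lra.
  (* Dividing by [c] turns the bounds on all [c * k i] into one on their supremum; for [c = 0] the
     index [i0] alone suffices. *)
  have [c0'|c0'] := leP c 0%R.
    have cE : c = 0%R by apply/le_anti; rewrite c0 c0'.
    by have := kN i0; rewrite cE; lra.
  suff : (D' <= (N' + d) / c)%R by rewrite ler_pdivlMr// mulrC; lra.
  rewrite -lee_fin DE; apply: ge_ereal_sup => _ [i _ <-].
  by rewrite lee_fin ler_pdivlMr// mulrC.
have D0 : (0 < D')%R by exact: lt_le_trans thetaD.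
exists (N' / D')%R; first by rewrite -NE -DE inver gt_eqF.
have -> : (N' / D' - c = (N' - c * D') / D')%R.
  by rewrite mulrBl mulfK// gt_eqF.
rewrite normrM normfV (gtr0_norm D0) ler_pM ?invr_ge0 ?(ltW D0)//.
  by rewrite ler_norml; lra.
by rewrite lef_pV2// posrE.
Qed.

Lemma max_kantorovich_dist (R : realType) (kappa h : R -> R)
    (B K theta m z w e C : R) :
  (0 < theta -> 0 < m -> 0 < z -> 0 < w -> 0 <= e -> 0 <= C ->
  (forall x, 0 < x -> `|kappa x| <= B) ->
  (forall s (j : int), 0 < s ->
    `|kappa (expR (- j%:~R) * s)| * `|j%:~R - ln s| ^+ 2 <= K) ->
  (forall x, 1 <= x <= expR 1 -> theta <= kappa x) ->
  (forall u, 0 < u -> 0 <= h u) ->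
  (forall v, w * `|h (expR v) - h z| <= e + C * (v - ln z) ^+ 2) ->
  2 * C * (K + B) <= e * m ^+ 2 ->
  exists2 q, max_kantorovich kappa h m z = q%:E &
    w * `|q - h z| <= (B + 1) * e / theta)%R.
Proof.
move=> theta0 m0 z0 w0 e0 C0 kB kK ktheta h0 hz Cm.
have lnzm : (ln (z `^ m) = m * ln z)%R by rewrite ln_powR.
pose k (j : int) := kappa (expR (- j%:~R) * z `^ m)%R.
pose d (j : int) :=
  ((e + 2 * C * ((j%:~R - m * ln z) ^+ 2 + 1) / m ^+ 2) / w)%R.
have m20 : (0 < m ^+ 2)%R by rewrite exprn_gt0.
have meanP (j : int) : exists r, (m%:E * \int[@completed_lebesgue_measure R]_(v
    in `[(j%:~R / m)%R, ((j%:~R + 1) / m)%R]) (h (expR v))%:E)%E = r%:E /\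
    (`|r - h z| <= d j)%R.
  have ab : (j%:~R / m <= (j%:~R + 1) / m)%R.
    by rewrite ler_pM2r ?invr_gt0// lerDl.
  have mab : (m * ((j%:~R + 1) / m - j%:~R / m) = 1)%R.
    by field; rewrite gt_eqF.
  have [v _|v vI|r -> rd] :=
      @mean_itv_dist R (h \o @expR R) _ _ m (h z) (d j) ab mab.
  - by rewrite h0 ?expR_gt0.
  - rewrite ler_pdivlMr// mulrC (le_trans (hz v))// lerD2l.
    rewrite ler_pdivlMr//; case/andP: vI; rewrite ler_pdivrMr// ler_pdivlMr//.
    set t : R := (j%:~R)%R => vl vu.
    suff /(ler_wpM2l C0) :
        ((v - ln z) ^+ 2 * m ^+ 2 <= 2 * ((t - m * ln z) ^+ 2 + 1))%R by lra.
    (* Put [T = t - m * ln z] and [s = v * m - t], so that [s] lies in [0, 1]. This square is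
       [(s - T)^2], whence [(T + s)^2 <= 2 T^2 + 2 s^2]; the next product gives [s^2 <= s <= 1]. *)
    have : (0 <= ((v - ln z) * m - 2 * (t - m * ln z)) ^+ 2)%R by exact: sqr_ge0.
    have : (0 <= (v * m - t) * (t + 1 - v * m))%R.
      by rewrite mulr_ge0// subr_ge0.
    by nra.
  - by exists r.
have /choice[r rP] := meanP.
(* For [j] the floor of [m * ln z], the point [e^-j z^m] lies in [1, e]. *)
have k0 : (theta <= k (Num.floor (m * ln z)))%R.
  apply: ktheta; rewrite -(@lnK _ (z `^ m)%R) ?posrE ?powR_gt0// lnzm -expRD.
  rewrite -[X in (X <= _)%R]expR0 !ler_expR.
  have := floor_le (m * ln z)%R; have := ltW (floorD1_gt (m * ln z)%R).
  by rewrite intrD; lra.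
(* The share [B * e] comes from the constant term of [d j]; the remaining [e] pays for the moment
   term, through [Cm]. *)
have kdist j : (`|k j| * `|r j - h z| <= (B + 1) * e / w)%R.
  apply: (@le_trans _ _ (`|k j| * d j)%R); first by rewrite ler_wpM2l ?(rP j).2.
  rewrite /d mulrA ler_pM2r ?invr_gt0//.
  have kjB : (`|k j| <= B)%R by rewrite kB// mulr_gt0 ?expR_gt0 ?powR_gt0.
  have kjK : (`|k j| * (j%:~R - m * ln z) ^+ 2 <= K)%R.
    have := kK (z `^ m)%R j; rewrite powR_gt0// lnzm real_normK ?num_real//.
    exact.
  have kjm : (2 * C * (`|k j| * (j%:~R - m * ln z) ^+ 2 + `|k j|) / m ^+ 2 <= e)%R.
    rewrite ler_pdivrMr// (le_trans _ Cm)// ler_wpM2l ?mulr_ge0//.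
    exact: lerD.
  have kje : (`|k j| * e <= B * e)%R by rewrite ler_wpM2r.
  rewrite (_ : (`|k j| * _)%R = (`|k j| * e + 2 * C * (`|k j| *
    (j%:~R - m * ln z) ^+ 2 + `|k j|) / m ^+ 2)%R); last by ring.
  by lra.
have kjB j : (k j <= B)%R.
  by rewrite (le_trans (ler_norm _))// kB// mulr_gt0 ?expR_gt0 ?powR_gt0.
have [q qE qd] := sup_quotient_dist theta0 (h0 _ z0) k0 kjB kdist.
exists q.
  rewrite -qE /max_kantorovich; congr (ereal_sup _ / _).
  apply: eq_imagel => j _; by rewrite (rP j).1 EFinM.
by rewrite mulrC -ler_pdivlMr// mulrAC.
Qed.

(** * Limits at infinity and quadratic majorants *)

Lemma near_dist_cvg (R : realType) (f : R -> \bar R) (l : R) :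
  (forall eps : R, (0 < eps)%R -> \forall m \near +oo%R,
    exists2 q, f m = q%:E & (`|q - l| <= eps)%R) ->
  f m @[m --> +oo%R] --> l%:E.
Proof.
move=> fl; apply/fine_cvgP; split.
  by apply: filterS (fl 1%R ltr01) => m [q -> _].
apply/cvgrPdist_le => eps eps0.
by apply: filterS (fl eps eps0) => m [q /= -> ?]; rewrite distrC.
Qed.

Lemma near_pinfty_le_sqr (R : realType) (c e : R) : (0 < e)%R ->
  \forall m \near +oo%R, (0 < m /\ c <= e * m ^+ 2)%R.
Proof.
move=> e0; near=> m.
have m1 : (1 <= m)%R by near: m; apply: nbhs_pinfty_ge; rewrite num_real.
have mc : (c / e <= m)%R by near: m; apply: nbhs_pinfty_ge; rewrite num_real.
split; first exact: lt_le_trans m1.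
rewrite mulrC -ler_pdivrMr// (le_trans mc)// expr2 ler_peMl//.
Unshelve. all: by end_near. Qed.

(** Once [|t|] exceeds [rho], the factor [t^2 / rho^2] exceeds 1 and the quadratic term alone
    dominates [a]. This merges a local modulus and a global bound into a majorant that a second
    moment controls. *)
Lemma le_add_quadratic (R : realType) (x e a rho t : R) :
  (0 < rho -> 0 <= e -> 0 <= a -> x <= a -> (`|t| <= rho -> x <= e) ->
  x <= e + a / rho ^+ 2 * t ^+ 2)%R.
Proof.
move=> rho0 e0 a0 xa xe; have rho20 : (0 < rho ^+ 2)%R by rewrite exprn_gt0.
have [/xe xe'|rt] := leP `|t|%R rho.
  by rewrite (le_trans xe')// lerDl mulr_ge0 ?sqr_ge0// divr_ge0// ltW.
rewrite (le_trans xa)// (@le_trans _ _ (a / rho ^+ 2 * t ^+ 2)%R) ?lerDr//.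
rewrite -mulrA ler_peMr// mulrC ler_pdivlMr// mul1r -(real_normK (num_real t)).
by rewrite ler_pXn2r// ?nnegrE// ltW.
Qed.

Lemma log_continuous_modulus (R : realType) (h : R -> R) (M z e : R) :
  (0 < e -> (forall u, 0 < u -> `|h u| <= M) -> 0 < z ->
  log_continuous_at h z -> exists2 C, 0 <= C &
    forall v, `|h (expR v) - h z| <= e + C * (v - ln z) ^+ 2)%R.
Proof.
move=> e0 hM z0 /(_ e e0)[rho rho0 hrho].
have M0 : (0 <= M)%R by exact: le_trans (hM z z0).
exists ((M + M) / rho ^+ 2)%R; first by rewrite divr_ge0 ?addr_ge0 ?sqr_ge0.
move=> v; apply: le_add_quadratic => //; rewrite ?addr_ge0 ?(ltW e0)//.
  by rewrite (le_trans (ler_normB _ _))// lerD ?hM ?expR_gt0.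
by move=> vz; rewrite ltW// hrho ?expR_gt0// expRK.
Qed.

(* With [g := weight * h], the increment [weight z * (h (expR v) - h z)] is
   [g (expR v) - g z + g (expR v) * ((v ^+ 2 - ln z ^+ 2) * weight z)]. *)
Lemma weighted_V_modulus (R : realType) (h : R -> R) (e : R) :
  weighted_V_space h -> (0 < e -> exists2 C, 0 <= C & forall z v, 0 < z ->
    weight z * `|h (expR v) - h z| <= e + C * (v - ln z) ^+ 2)%R.
Proof.
move=> [/ex_strict_bound_gt0[G G0 gG] ucg] e0.
set g := (fun z => weight z * h z)%R in gG ucg.
have {}gG z : (0 < z -> `|g z| <= G)%R.
  by move=> z0; apply/ltW/gG; rewrite /= in_itv/= z0.
(* The increment of [g] costs [e'] and that of the weight costs [G * e']; together they make [e]. *)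
pose e' := (e / (1 + G))%R.
have e'0 : (0 < e')%R by rewrite divr_gt0// addr_gt0.
have eE : (e = e' + G * e')%R by rewrite /e'; field; rewrite gt_eqF// addr_gt0.
clearbody e'; have [rho rho0 grho] := ucg e' e'0.
exists ((G + G) / rho ^+ 2 + G * (1 + e'^-1))%R.
  rewrite addr_ge0//; first by rewrite divr_ge0 ?sqr_ge0 ?addr_ge0 ?ltW.
  by rewrite mulr_ge0 ?addr_ge0 ?invr_ge0 ?(ltW e'0) ?(ltW G0).
move=> z v z0; set t := (v - ln z)%R.
have weight_neq0 (x : R) : (1 + x ^+ 2 != 0)%R.
  by rewrite gt_eqF// ltr_pwDl// sqr_ge0.
have w0 : (0 < 1 + ln z ^+ 2)%R by rewrite ltr_pwDl// sqr_ge0.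
have -> : (weight z * `|h (expR v) - h z| = `|g (expR v) - g z +
    g (expR v) * ((v ^+ 2 - ln z ^+ 2) / (1 + ln z ^+ 2))|)%R.
  have wz0 : (0 <= weight z)%R by rewrite /weight invr_ge0 ltW.
  rewrite -{1}(ger0_norm wz0) -normrM; congr (`| _ |)%R.
  rewrite /g /weight expRK; field.
  by rewrite !weight_neq0.
have gdist : (`|g (expR v) - g z| <= e' + (G + G) / rho ^+ 2 * t ^+ 2)%R.
  apply: le_add_quadratic => //; rewrite ?addr_ge0 ?(ltW e'0) ?(ltW G0)//.
    by rewrite (le_trans (ler_normB _ _))// lerD ?gG ?expR_gt0.
  by move=> tr; rewrite ltW// grho ?expR_gt0// expRK.
(* Since [v^2 - ln z^2 = t^2 + 2 t ln z] and [2 |ln z| <= 1 + ln z^2], the quotient is at most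
   [t^2 + |t|], uniformly in [z]; the linear term is split by [|t| <= e' + t^2 / e']. *)
have wdist : (`|(v ^+ 2 - ln z ^+ 2) / (1 + ln z ^+ 2)| <=
    e' + (1 + e'^-1) * t ^+ 2)%R.
  rewrite normrM normfV (gtr0_norm w0) ler_pdivrMr//.
  have te : (`|t| <= e' + e'^-1 * t ^+ 2)%R.
    rewrite -(ler_pM2l e'0) mulrDr mulVKf ?gt_eqF//.
    rewrite -(real_normK (num_real t)).
    by have := sqr_ge0 (e' - `|t|)%R; have := normr_ge0 t; nra.
  have -> : (v ^+ 2 - ln z ^+ 2 = t ^+ 2 + 2 * ln z * t)%R by rewrite /t; ring.
  rewrite (le_trans (ler_normD _ _))// (ger0_norm (sqr_ge0 t)) 2!normrM.
  rewrite (ger0_norm (ler0n _ 2)).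
  have L2 : (2 * `|ln z| <= 1 + ln z ^+ 2)%R.
    rewrite -(real_normK (num_real (ln z))).
    by have := sqr_ge0 (1 - `|ln z|)%R; lra.
  have h1 : (2 * `|ln z| * `|t| <= (1 + ln z ^+ 2) * (e' + e'^-1 * t ^+ 2))%R.
    by rewrite ler_pM ?mulr_ge0.
  have h2 : (0 <= ln z ^+ 2 * t ^+ 2)%R by rewrite mulr_ge0 ?sqr_ge0.
  by lra.
rewrite (le_trans (ler_normD _ _))// normrM.
have gw : (`|g (expR v)| * `|(v ^+ 2 - ln z ^+ 2) / (1 + ln z ^+ 2)| <=
    G * (e' + (1 + e'^-1) * t ^+ 2))%R.
  by rewrite ler_pM ?gG ?expR_gt0.
by rewrite eE; lra.
Qed.

Theorem theorem3p2 (R : realType) (kappa : R -> R)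
  (kappa_bounded : [bounded kappa x | x in `]0%R, +oo[])
  (kappa_measurable : lebesgue_measurable_fun `]0%R, +oo[ kappa)
  (kappa_moment : discrete_moment2 kappa < +oo)
  (kappa_inf : (0 < inf [set kappa x | x in `[1, expR 1]])%R) :
  (forall h : R -> R,
    (forall z, 0 < z -> 0 < h z)%R ->
    [bounded h z | z in `]0%R, +oo[] ->
    lebesgue_locally_integrable `]0%R, +oo[ h ->
    forall z, (0 < z)%R -> log_continuous_at h z ->
      max_kantorovich kappa h m z @[m --> +oo%R] --> (h z)%:E) /\
  (forall h : R -> R, weighted_V_space_nneg h ->
    weighted_norm (fun z => max_kantorovich kappa h m z - (h z)%:E)
      @[m --> +oo%R] --> 0).
Proof.
have /ex_strict_bound_gt0[B B0 kB] := kappa_bounded.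
have {}kB x : (0 < x -> `|kappa x| <= B)%R.
  by move=> x0; apply/ltW/kB; rewrite /= in_itv/= x0.
have [K kK] : exists K : R, (forall s (j : int), 0 < s ->
    `|kappa (expR (- j%:~R) * s)| * `|j%:~R - ln s| ^+ 2 <= K)%R.
  have kle s (j : int) : (0 < s)%R ->
      (`|kappa (expR (- j%:~R) * s)| * `|j%:~R - ln s| ^+ 2)%:E <=
      discrete_moment2 kappa.
    move=> s0; apply: le_ereal_sup_tmp; eexists.
      by exists s => //; rewrite /= in_itv/= s0.
    by apply: ereal_sup_ubound; exists j.
  exists (fine (discrete_moment2 kappa)) => s j s0.
  (* [fine] is faithful only on finite values; the term at [s = 1], [j = 0] excludes [-oo]. *)
  rewrite -lee_fin fineK ?kle// fin_real// kappa_moment andbT.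
  exact: lt_le_trans (ltNyr _) (kle 1%R 0%R ltr01).
set theta := inf _ in kappa_inf.
have ktheta x : (1 <= x <= expR 1 -> theta <= kappa x)%R.
  move=> x1; apply: ge_inf; last by exists x.
  exists (- B)%R => _ [y /= + <-]; rewrite in_itv/= => /andP[y1 _].
  by have := kB y (lt_le_trans ltr01 y1); rewrite ler_norml => /andP[].
(* The order of quantifiers matters: [e] depends on [eps] only, so [C] may be chosen from [e], and
   the threshold for [m] is then uniform in [z] and [w]. *)
have near_approx eps : (0 < eps)%R -> exists2 e, (0 < e)%R &
    forall h C, (forall u, 0 < u -> 0 <= h u)%R -> (0 <= C)%R ->
    \forall m \near +oo%R, forall z w, (0 < z)%R -> (0 < w)%R ->
    (forall v, w * `|h (expR v) - h z| <= e + C * (v - ln z) ^+ 2)%R ->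
    exists2 q, max_kantorovich kappa h m z = q%:E & (w * `|q - h z| <= eps)%R.
  move=> eps0; pose e := (eps * theta / (B + 1))%R.
  have B10 : (0 < B + 1)%R by rewrite addr_gt0.
  have e0 : (0 < e)%R by rewrite divr_gt0 ?mulr_gt0.
  exists e => // h C h0 C0.
  apply: filterS (near_pinfty_le_sqr (2 * C * (K + B))%R e0) => m [m0 mC] z w z0 w0 hz.
  have [q qE qh] := max_kantorovich_dist kappa_inf m0 z0 w0 (ltW e0) C0 kB kK
    ktheta h0 hz mC.
  exists q => //; rewrite (le_trans qh)// /e.
  by rewrite (mulrC (B + 1)%R) divfK ?mulfK ?gt_eqF.
split=> [h h0 /ex_strict_bound_gt0[M _ hM] _ z z0 hz|h [hV h0]].
  apply: near_dist_cvg => eps /near_approx[e e0 approx].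
  have {}hM u : (0 < u -> `|h u| <= M)%R.
    by move=> u0; apply/ltW/hM; rewrite /= in_itv/= u0.
  have [C C0 hC] := log_continuous_modulus e0 hM z0 hz.
  have := approx h C (fun u u0 => ltW (h0 u u0)) C0.
  apply: filterS => m /(_ z 1%R z0 ltr01)[v|q qE].
    by rewrite mul1r.
  by rewrite mul1r; exists q.
apply: near_dist_cvg => eps /near_approx[e e0 approx].
have [C C0 hC] := weighted_V_modulus hV e0.
apply: filterS (approx h C h0 C0) => m {}approx.
set N := weighted_norm _.
have wz0 (z : R) : (0 < weight z)%R.
  by rewrite /weight invr_gt0 ltr_pwDl// sqr_ge0.
have Neps : N <= eps%:E.
  apply: ge_ereal_sup => _ [z /= + <-]; rewrite in_itv/= andbT => z0.
  have [q -> qh] := approx z (weight z) z0 (wz0 z) (fun v => hC z v z0).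
  by rewrite -EFinB abse_EFin -EFinM lee_fin.
(* The point 1 shows that the supremum is over a nonempty family, hence not [-oo]. *)
have N0 : 0 <= N.
  apply: le_ereal_sup_tmp; eexists; first by exists 1%R; rewrite //= in_itv/= ltr01.
  by rewrite mule_ge0// lee_fin ltW.
have Nfin : N \is a fin_num.
  by rewrite ge0_fin_numE// (le_lt_trans Neps (ltry _)).
exists (fine N); first by rewrite fineK.
by rewrite subr0 ger0_norm ?fine_ge0// -lee_fin fineK.
Qed.
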